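(* (In ZFC set theory.) A graph $G$ is a generalized Cayley graph of a group (that is, $G=\mathcal{C}\langle M,Q\rangle$ for some group $M$, some subset $Q\subseteq M$, and some injective labeling $\langle\,\rangle:Q\to A$) if and only if $G$ is simple, deterministic, co-deterministic and symmetric.
   Context: A graph is a non-empty set $G\subseteq V\times A\times V$ of labeled edges $s\xrightarrow{a}_G t$; $V_G$ is the set of vertices occurring in edges. For a magma $(M,\cdot)$, $Q\subseteq M$ and injective $\langle\,\rangle:Q\to A$, $\mathcal{C}\langle M,Q\rangle=\{(p,\langle q\rangle,p\cdot q): p\in M,\ q\in Q\}$. $G$ is simple if no two edges share source and target; deterministic if $r\xrightarrow{a}s$, $r\xrightarrow{a}t$ imply $s=t$; co-deterministic if $s\xrightarrow{a}r$, $t\xrightarrow{a}r$ imply $s=t$; symmetric if for all $s,t\in V_G$ some automorphism of the labeled graph $G$ maps $s$ to $t$. *)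

(* Defs.v *)
From HB Require Import structures.
From mathcomp Require Import all_boot.
From mathcomp Require Import boolp classical_sets functions.

Set Implicit Arguments.
Unset Strict Implicit.
Unset Printing Implicit Defensive.

Local Open Scope classical_set_scope.

(* A set of labeled edges; (s, a, t) is the edge from s to t labeled by a.
   A graph is moreover nonempty: this is stated as G !=set0 where needed. *)
Definition edge_set (V A : Type) := set (V * A * V).

Section Graphs.
Variables (V A : Type).
Implicit Type G : edge_set V A.

Definition vertices G : set V :=
  [set s | exists a t, G (s, a, t) \/ G (t, a, s)].

Definition simple G :=
  forall s a b t, G (s, a, t) -> G (s, b, t) -> a = b.

Definition deterministic G :=
  forall r a s t, G (r, a, s) -> G (r, a, t) -> s = t.

Definition co_deterministic G :=
  forall r a s t, G (s, a, r) -> G (t, a, r) -> s = t.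

(* The values of f outside of the vertices of G are irrelevant. *)
Definition automorphism G (f : V -> V) :=
  set_bij (vertices G) (vertices G) f /\
  forall s a t, vertices G s -> vertices G t ->
    (G (s, a, t) <-> G (f s, a, f t)).

Definition symmetric_graph G :=
  forall s t, vertices G s -> vertices G t ->
    exists2 f, automorphism G f & f s = t.

End Graphs.

(* The graph C<M, Q> for the labeling lab : Q -> A (intended injective). *)
Definition gcayley (M : magmaType) (Q : set M) (A : Type) (lab : Q -> A) :
    edge_set M A :=
  [set e | exists (p : M) (q : Q), e = (p, lab q, (p * val q)%g)].

(* An edge set over a subset M of V, seen as an edge set over V. *)
Definition edge_incl (V A : Type) (M : set V) (H : edge_set M A) :
    edge_set V A :=
  [set (val e.1.1, e.1.2, val e.2) | e in H].

(* G is equal to (not merely isomorphic to) some C<M, Q>, so the carrier of the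
   group M has to be a subset of V; gM is a group structure on that subset. *)
Definition gcayley_of_group (V A : Type) (G : edge_set V A) :=
  exists (M : set V) (gM : Group M) (Q : set M) (lab : Q -> A),
    injective lab /\ G = edge_incl (@gcayley (Group.Pack gM) Q A lab).

(* Main.v *)
(* Left translations give the forward direction. Conversely, on a connected
   component of a deterministic and co-deterministic graph, a label-preserving
   map is determined by its value at one vertex; hence symmetry makes each
   component a Cayley graph, and all components are isomorphic. The vertex set is
   then the product of one component by the set I of components, and it remains
   to put a group structure on I.

   Any nonempty set carries a group structure: Z/n if it is finite. If X is
   infinite, Zorn's lemma gives a maximal elementary abelian 2-group Z on a subset
   of X among those containing a fixed copy of (nat, xor). If Z injected into its
   complement, Z x Z/2 would contradict maximality; so the complement injects
   into Z, hence X injects into Z + Z. Decomposing Z into cosets of nat shows that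
   Z + Z injects into Z, so X and Z are equipotent. *)

Require Import Defs.
From HB Require Import structures.
From Stdlib Require PeanoNat.
From mathcomp Require Import all_boot zmodp.
From mathcomp Require Import boolp classical_sets functions cardinality.

Set Implicit Arguments.
Unset Strict Implicit.
Unset Printing Implicit Defensive.

Local Open Scope classical_set_scope.
Local Open Scope card_scope.

(** * Building group structures; comparability of cardinals *)

(** The equality and choice structures underlying a group come from classical logic, so any bare
    type qualifies as carrier. *)
Definition group_of_axioms (T : Type) (one : T) (inv : T -> T)
    (mul : T -> T -> T) (mulA : associative mul)
    (mul1 : left_id one mul) (mulx1 : right_id one mul)
    (mulV : left_inverse one inv mul) (mulxV : right_inverse one inv mul) :
    Group T :=
  let C : choiceType := HB.pack T (gen_eqMixin T) (gen_choiceMixin T) in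
  Group.class (HB.pack_for groupType T C
    (@isGroup.Build C one inv mul mulA mul1 mulx1 mulV mulxV)).

Lemma group_of_bij (T : Type) (gT : groupType) (f : T -> gT) (g : gT -> T) :
  cancel f g -> cancel g f -> inhabited (Group T).
Proof.
move=> fK gK; apply: inhabits.
apply: (@group_of_axioms T (g 1%g) (fun x => g (f x)^-1%g)
          (fun x y => g (f x * f y)%g)).
- by move=> x y z; rewrite !gK mulgA.
- by move=> x; rewrite gK mul1g fK.
- by move=> x; rewrite gK mulg1 fK.
- by move=> x; rewrite gK mulVg.
- by move=> x; rewrite gK mulgV.
Qed.

(** Zorn's lemma gives a maximal partial matching between [A] and [B]. It exhausts one of the two
    sets, since otherwise an unmatched pair could be added to it. *)
Lemma card_le_total (T U : Type) (A : set T) (B : set U) :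
  A #<= B \/ B #<= A.
Proof.
elim/Ppointed: T => T in A *; first by left; rewrite emptyE_subdef.
elim/Ppointed: U => U in B *; first by right; rewrite emptyE_subdef.
pose matching (R : set (T * U)) := R `<=` A `*` B /\
  forall p q, R p -> R q -> (p.1 = q.1 <-> p.2 = q.2).
have [|R [[RAB Rinj] Rmax]] := @Zorn_bigcup _ matching.
  move=> F FP Ftot; split; first by move=> p [R /FP[RAB _]]; exact: RAB.
  move=> p q [R FR Rp] [S FS Sq].
  have [RS|SR] := Ftot _ _ FR FS.
  - by apply: (FP _ FS).2 => //; exact: RS.
  - by apply: (FP _ FR).2 => //; exact: SR.
have [RA|/existsNP[x /not_implyP[Ax Rx]]] :=
    pselect (forall x, A x -> exists y, R (x, y)).
  left; apply/pcard_leP/injfunPex.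
  pose f x := xget point [set y | R (x, y)].
  have fP x : A x -> R (x, f x).
    by move=> /RA[y]; exact: (@xgetI _ point [set y | R (x, y)]).
  exists f => [x /fP /RAB[]//|x y /set_mem /fP Rx /set_mem /fP Ry fxy].
  exact: (Rinj _ _ Rx Ry).2.
have [RB|/existsNP[y /not_implyP[By Ry]]] :=
    pselect (forall y, B y -> exists x, R (x, y)).
  right; apply/pcard_leP/injfunPex.
  pose f y := xget point [set z | R (z, y)].
  have fP y : B y -> R (f y, y).
    by move=> /RB[z]; exact: (@xgetI _ point [set z | R (z, y)]).
  exists f => [y /fP /RAB[]//|y z /set_mem /fP Ry /set_mem /fP Rz fyz].
  exact: (Rinj _ _ Ry Rz).1.
exfalso; apply: (Rmax (R `|` [set (x, y)])).
  by split=> [p|/(_ (x, y) (or_intror erefl)) Rxy]; [left|apply: Rx; exists y].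
split=> [p [/RAB//|->//]|p q [Rp|->] [Rq|->] //=]; first exact: Rinj.
- case: p Rp => p1 p2 Rp /=.
  by split=> ?; subst; [case: Rx; exists p2|case: Ry; exists p1].
- case: q Rq => q1 q2 Rq /=.
  by split=> ?; subst; [case: Rx; exists q2|case: Ry; exists q1].
Qed.

(** * Elementary abelian 2-groups on subsets of a type *)

Record boolean_group (T : Type) (e : T) (Z : set T) (op : T -> T -> T) : Prop :=
  BooleanGroup {
    bg1 : Z e;
    bgM : forall x y, Z x -> Z y -> Z (op x y);
    bgA : forall x y z, Z x -> Z y -> Z z -> op x (op y z) = op (op x y) z;
    bgC : forall x y, Z x -> Z y -> op x y = op y x;
    bg1x : forall x, Z x -> op e x = x;
    bgxx : forall x, Z x -> op x x = e
  }.

Lemma bgK (T : Type) (e : T) Z op : boolean_group e Z op ->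
  forall x y, Z x -> Z y -> op x (op x y) = y.
Proof. by move=> H x y Zx Zy; rewrite (bgA H)// (bgxx H)// (bg1x H). Qed.

(** With [phi] injective, this marks a copy of (nat, xor), a countable direct sum of copies of Z/2,
    as a subgroup of [Z]. *)
Definition xor_morph (T : Type) (phi : nat -> T) (Z : set T)
    (op : T -> T -> T) :=
  (forall n, Z (phi n)) /\
  forall m n, op (phi m) (phi n) = phi (PeanoNat.Nat.lxor m n).

Section BooleanGroups.
Variables (T : pointedType) (phi : nat -> T).
Hypothesis phi_inj : injective phi.

Lemma boolean_group_range : exists op,
  boolean_group (phi 0) (range phi) op /\ xor_morph phi (range phi) op.
Proof.
pose g x := xget 0 [set n | phi n = x].
have gK n : g (phi n) = n.
  by apply: phi_inj; apply: (@xgetPex _ 0 [set m | phi m = phi n]); exists n.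
exists (fun x y => phi (PeanoNat.Nat.lxor (g x) (g y))); split; split.
- by exists 0.
- by move=> x y _ _; eexists.
- by move=> x y z _ _ _; rewrite !gK PeanoNat.Nat.lxor_assoc.
- by move=> x y _ _; rewrite PeanoNat.Nat.lxor_comm.
- by move=> _ [n _ <-]; rewrite !gK PeanoNat.Nat.lxor_0_l.
- by move=> _ [n _ <-]; rewrite !gK PeanoNat.Nat.lxor_nilpotent.
- by move=> n; exists n.
- by move=> m n; rewrite !gK.
Qed.

(* Z is a disjoint union of cosets of the image of phi, and nat * bool injects
   into nat. *)
Lemma boolean_group_double (Z : set T) op :
  boolean_group (phi 0) Z op -> xor_morph phi Z op ->
  exists psi : T -> bool -> T, (forall x b, Z x -> Z (psi x b)) /\
    forall x b y c, Z x -> Z y -> psi x b = psi y c -> x = y /\ b = c.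
Proof.
move=> H [Zphi phiM].
(* As every element is its own inverse, [op x z] is the difference of [x] and [z]: this is the coset
   of [x] modulo the image of [phi]. *)
pose coset x := [set z | Z z /\ exists n, op x z = phi n].
pose rep x := xget point (coset x).
have repP x : Z x -> coset x (rep x).
  move=> Zx; apply: (xgetPex point); exists x; split=> //; exists 0.
  exact: (bgxx H).
have coset_phi x n : Z x -> coset (op x (phi n)) = coset x.
  move=> Zx; have Zn := Zphi n; apply/seteqP; split=> z [Zz [k zk]]; split=> //;
    exists (PeanoNat.Nat.lxor n k).
    rewrite -phiM -zk (bgC H Zx Zn) -(bgA H)// (bgK H)//; exact: (bgM H).
  by rewrite -phiM -zk (bgC H Zx Zn) -(bgA H).
have ZrepP x : Z x -> exists2 n, Z (rep x) & x = op (rep x) (phi n).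
  move=> Zx; have [Zr [n xr]] := repP x Zx.
  by exists n => //; rewrite -xr (bgC H Zx)// (bgK H).
have /choice[num numP] x : exists n, Z x -> x = op (rep x) (phi n).
  by have [/ZrepP[n _ ?]|] := pselect (Z x); [exists n|exists 0].
have Zrep x : Z x -> Z (rep x) by case/repP.
have rep_op x n : Z x -> rep (op (rep x) (phi n)) = rep x.
  move=> Zx; rewrite /rep coset_phi; last exact: Zrep.
  by rewrite -[coset (rep x)](coset_phi _ (num x)) -?numP//; exact: Zrep.
(* Each [x] is [rep x] times [phi (num x)]. Doubling the index frees its parity to store [b], and
   the coset is unchanged. *)
exists (fun x b => op (rep x) (phi (b + (num x).*2))); split.
  by move=> x b Zx; apply: (bgM H) => //; exact: Zrep.
move=> x b y c Zx Zy E.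
have Er : rep x = rep y by rewrite -(rep_op x (b + (num x).*2))// E rep_op.
move: E; rewrite Er => /(congr1 (op (rep y))).
rewrite !(bgK H) //; [|exact: Zrep..] => /phi_inj E.
have Eb : b = c by move/(congr1 odd): E; rewrite !oddD !odd_double !addbF !oddb.
split=> //; rewrite (numP x)// (numP y)// Er; congr (op _ (phi _)).
by apply: double_inj; move: E; rewrite Eb => /addnI.
Qed.

(** An injection [j] of [Z] into its complement provides a disjoint second copy of [Z]. The union of
    [Z] and [j(Z)] then carries the structure of Z x Z/2, in which [Z] is the subgroup of index
    2. *)
Lemma boolean_group_extend (e : T) (Z : set T) op :
  boolean_group e Z op -> Z #<= ~` Z ->
  exists Z' op', [/\ boolean_group e Z' op', Z `<=` Z', ~ Z' `<=` Z &
    forall x y, Z x -> Z y -> op x y = op' x y].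
Proof.
move=> H /pcard_leP/injfunPex[j jZ /in_set2P jinj].
pose dec x b := if b then j x else x.
pose Z' := [set x | exists2 y, Z y & exists b, x = dec y b].
(* [co] reads off the coordinates in Z x Z/2; its value outside [Z'] is arbitrary. *)
have /choice[co coP] x : exists p, Z' x -> Z p.1 /\ x = dec p.1 p.2.
  have [[y Zy [b xE]]|] := pselect (Z' x); first by exists (y, b).
  by exists (point, true).
have dec_inj x b y c : Z x -> Z y -> dec x b = dec y c -> (x, b) = (y, c).
  case: b; case: c => //= Zx Zy.
  - by move=> /jinj ->.
  - by move=> E; case: (jZ x Zx); rewrite E.
  - by move=> E; case: (jZ y Zy); rewrite -E.
  - by move=> ->.
have Zdec x b : Z x -> Z' (dec x b) by move=> Zx; exists x => //; exists b.
have decK x b : Z x -> co (dec x b) = (x, b).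
  move=> Zx; have [Zc E] := coP _ (Zdec _ b Zx).
  by have := dec_inj _ _ _ _ Zx Zc E; case: (co _).
pose op' x y := dec (op (co x).1 (co y).1) ((co x).2 (+) (co y).2).
have ZM x y : Z x -> Z y -> Z (op x y) by exact: (bgM H).
exists Z', op'; split.
- split.
  + exact: (Zdec _ false (bg1 H)).
  + by move=> x y /coP[Zx _] /coP[Zy _]; apply: Zdec; exact: ZM.
  + move=> x y z /coP[Zx _] /coP[Zy _] /coP[Zz _].
    by rewrite /op' !decK ?(bgA H) ?addbA//; exact: ZM.
  + by move=> x y /coP[Zx _] /coP[Zy _]; rewrite /op' (bgC H Zx Zy) addbC.
  + move=> x /coP[Zx xE]; rewrite /op' (decK e false (bg1 H)) /=.
    by rewrite (bg1x H)// -xE.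
  + by move=> x /coP[Zx xE]; rewrite /op' addbb (bgxx H).
- by move=> x Zx; exists x => //; exists false.
- by move=> /(_ _ (Zdec _ true (bg1 H))); exact: (jZ _ (bg1 H)).
- by move=> x y Zx Zy; rewrite /op' (decK x false)// (decK y false).
Qed.

Lemma boolean_group_maximal : exists Z op,
  [/\ boolean_group (phi 0) Z op, xor_morph phi Z op & ~ (Z #<= ~` Z)].
Proof.
pose bg := {p : set T * (T -> T -> T) |
             boolean_group (phi 0) p.1 p.2 /\ xor_morph phi p.1 p.2}.
(* The subgroup order. It is only a preorder, because two operations may agree on the carrier and
   differ outside it. *)
pose le (p q : set T * (T -> T -> T)) := p.1 `<=` q.1 /\
  forall x y, p.1 x -> p.1 y -> p.2 x y = q.2 x y.
pose R (p q : bg) := `[< le (sval p) (sval q) >].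
have [op0 [bg0 xm0]] := boolean_group_range.
pose b0 : bg := exist _ (range phi, op0) (conj bg0 xm0).
have [||A totA|[[Z op] [/= H phiP]] Zmax] := @ZL_preorder bg b0 R.
- by move=> p; apply/asboolP; split.
- move=> q p r /asboolP[qp qpM] /asboolP[pr prM]; apply/asboolP; split.
    exact: subset_trans qp pr.
  by move=> x y qx qy; rewrite qpM// prM//; exact: qp.
- have [[p0 Ap0]|A0] := pselect (A !=set0); last first.
    by exists b0 => p Ap; case: A0; exists p.
  pose Z := [set x | exists2 p, A p & (sval p).1 x].
  (* The product in the union of the chain is computed in any member containing both factors; [opE]
     shows that the choice of the member is immaterial. *)
  pose prod x y := [set z | exists p, [/\ A p, (sval p).1 x, (sval p).1 y &
                                         z = (sval p).2 x y]].
  pose op x y := xget point (prod x y).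
  have common p q : A p -> A q -> exists r,
      [/\ A r, le (sval p) (sval r) & le (sval q) (sval r)].
    move=> Ap Aq; have [/asboolP pq|/asboolP qp] := totA p q Ap Aq.
    - by exists q; split=> //; split.
    - by exists p; split=> //; split.
  have opE p x y : A p -> (sval p).1 x -> (sval p).1 y ->
      op x y = (sval p).2 x y.
    move=> Ap px py; have : prod x y (op x y).
      by apply: (xgetPex point); exists ((sval p).2 x y), p.
    move=> [q [Aq qx qy ->]].
    have [r [Ar [pr prM] [qr qrM]]] := common p q Ap Aq.
    by rewrite prM// qrM.
  have Z2 x y : Z x -> Z y -> exists p, [/\ A p, (sval p).1 x & (sval p).1 y].
    move=> [p Ap px] [q Aq qy].
    have [r [Ar [pr _] [qr _]]] := common p q Ap Aq.
    by exists r; split; [|exact: pr|exact: qr].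
  have Z3 x y z : Z x -> Z y -> Z z ->
      exists p, [/\ A p, (sval p).1 x, (sval p).1 y & (sval p).1 z].
    move=> Zx Zy [q Aq qz]; have [p [Ap px py]] := Z2 x y Zx Zy.
    have [r [Ar [pr _] [qr _]]] := common p q Ap Aq.
    by exists r; split; [|exact: pr|exact: pr|exact: qr].
  have HA (p : bg) := (svalP p).1.
  have bgZ : boolean_group (phi 0) Z op.
    split.
    + by exists p0 => //; exact: (bg1 (HA p0)).
    + move=> x y Zx Zy; have [p [Ap px py]] := Z2 x y Zx Zy.
      by exists p => //; rewrite (opE p)//; exact: (bgM (HA p)).
    + move=> x y z Zx Zy Zz; have [p [Ap px py pz]] := Z3 x y z Zx Zy Zz.
      have pM := bgM (HA p).
      by rewrite !(opE p)//; [exact: (bgA (HA p))| exact: pM..].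
    + move=> x y Zx Zy; have [p [Ap px py]] := Z2 x y Zx Zy.
      by rewrite !(opE p)//; exact: (bgC (HA p)).
    + move=> x [p Ap px]; have p1 := bg1 (HA p).
      by rewrite (opE p)//; exact: (bg1x (HA p)).
    + by move=> x [p Ap px]; rewrite (opE p)//; exact: (bgxx (HA p)).
  have xmZ : xor_morph phi Z op.
    have [pphi pphiM] := (svalP p0).2; split; first by exists p0.
    by move=> m n; rewrite (opE p0).
  exists (exist _ (Z, op) (conj bgZ xmZ)) => p Ap; apply/asboolP; split=> /=.
    by move=> x px; exists p.
  by move=> x y px py; rewrite (opE p).
- exists Z, op; split=> // ZC.
  have [Z' [op' [H' ZZ' Z'Z ZM]]] := boolean_group_extend H ZC.
  have phiP' : xor_morph phi Z' op'.
    by have [Zphi phiM] := phiP; split=> [n|m n]; [exact: ZZ'|rewrite -ZM].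
  have [] // : le (Z', op') (Z, op).
  apply/asboolP; apply: (Zmax (exist _ (Z', op') (conj H' phiP'))).
  by apply/asboolP; split.
Qed.

End BooleanGroups.

(** * A group structure on every nonempty type *)

Lemma inhabited_group (T : Type) (x0 : T) : inhabited (Group T).
Proof.
elim/Ppointed: T => T in x0 *; first by case: (no x0).
have [/finite_setP[[|n]]|/infiniteP] := pselect (finite_set [set: T]).
- by rewrite II0 card_eq0 => /eqP /seteqP[/(_ x0 I)].
- move=> /card_eq_trans/(_ card_II) /card_esym /card_set_bijP[f].
  rewrite setTT_bijective => -[g fK gK]; exact: group_of_bij gK fK.
move=> /pcard_leP/injfunPex[phi _ /in2TT phi_inj].
have [Z [op [H phiP ZC]]] := boolean_group_maximal phi_inj.
have [psi [Zpsi psi_inj]] := boolean_group_double phi_inj H phiP.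
have /pcard_leP/injfunPex[j jZ /in_set2P jinj] : ~` Z #<= Z.
  by have [/ZC|] := card_le_total Z (~` Z).
(* The bit given to [psi] separates the images of [Z] and of its complement, the latter being first
   sent into [Z] by [j]. *)
have TZ : [set: T] #<= Z.
  apply/pcard_leP/injfunPex.
  exists (fun x => if x \in Z then psi x false else psi (j x) true).
    move=> x _; case: ifPn => xZ; apply: Zpsi; first exact: set_mem.
    by apply: jZ => /mem_set; exact/negP.
  have jZP x : x \notin Z -> Z (j x) by move=> /negP xZ; apply: jZ => /mem_set.
  move=> x y _ _; case: ifPn => xZ; case: ifPn => yZ.
  - by move=> /psi_inj[]//; exact: set_mem.
  - by move=> /psi_inj[]//; [exact: set_mem|exact: jZP].
  - by move=> /psi_inj[]//; [exact: jZP|exact: set_mem].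
  - move=> /psi_inj[||]; [exact: jZP|exact: jZP|move=> E _].
    by apply: jinj => // /mem_set; exact/negP.
have /card_set_bijP[f [fZ /in2TT f_inj f_surj]] : [set: T] #= Z.
  by apply: Cantor_Bernstein => //; exact: card_leT.
pose g z := xget point [set x | f x = z].
have gK z : Z z -> f (g z) = z.
  by move=> /f_surj[x _ xz]; exact: (@xgetI _ point [set x | f x = z] x).
have {}fZ x : Z (f x) by exact: fZ.
have fK : cancel f g by move=> x; apply: f_inj; rewrite gK.
have opZ x y : Z (op (f x) (f y)) by exact: (bgM H).
have op1 := bg1 H.
apply: inhabits.
(* The structure of [Z] is transported along the bijection [f]; inversion is the identity in a group
   of exponent 2. *)
apply: (@group_of_axioms T (g (phi 0)) id (fun x y => g (op (f x) (f y)))).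
- by move=> x y z; rewrite !gK// (bgA H).
- by move=> x; rewrite gK// (bg1x H)// fK.
- by move=> x; rewrite gK// (bgC H)// (bg1x H)// fK.
- by move=> x; rewrite (bgxx H).
- by move=> x; rewrite (bgxx H).
Qed.

(** * Group structure on a vertex-transitive labeled graph *)

Section Homogeneous.
Variables (T A : Type) (E : T -> A -> T -> Prop).
Hypothesis Edet : forall r a s t, E r a s -> E r a t -> s = t.
Hypothesis Ecodet : forall r a s t, E s a r -> E t a r -> s = t.

(** The equivalence relation generated by the edges, encoded impredicatively: induction along an
    undirected path amounts to choosing [P]. *)
Definition connected (s t : T) :=
  forall P : T -> Prop, (forall x a y, E x a y -> P x <-> P y) -> P s -> P t.

Lemma connected_refl s : connected s s. Proof. by []. Qed.

Lemma connected_trans s t u : connected s t -> connected t u -> connected s u.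
Proof. by move=> st tu P PE /(st P PE); exact: tu. Qed.

Lemma connected_sym s t : connected s t -> connected t s.
Proof.
move=> /(_ (connected^~ s)); apply; last exact: connected_refl.
move=> x a y xy.
have cxy : connected x y by move=> P /(_ _ _ _ xy)[].
have cyx : connected y x by move=> P /(_ _ _ _ xy)[].
by split; [exact: connected_trans cyx|exact: connected_trans cxy].
Qed.

Lemma connected_edge s a t : E s a t -> connected s t.
Proof. by move=> st P /(_ _ _ _ st)[]. Qed.

Definition edge_morph (f : T -> T) := forall s a t, E s a t -> E (f s) a (f t).

Lemma edge_morph_comp f g :
  edge_morph f -> edge_morph g -> edge_morph (f \o g).
Proof. by move=> fE gE s a t /gE /fE. Qed.

Lemma edge_morph_connected f s t :
  edge_morph f -> connected s t -> connected (f s) (f t).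
Proof.
move=> fE /(_ (fun x => connected (f s) (f x))); apply;
  last exact: connected_refl.
move=> x a y /fE xy; have cxy := connected_edge xy.
by split=> [sx|sy]; [exact: connected_trans sx cxy|
                     exact: connected_trans sy (connected_sym cxy)].
Qed.

(** Agreement of [f] and [g] propagates forward along an edge by determinism and backward by
    co-determinism. *)
Lemma edge_morph_eq f g s t : edge_morph f -> edge_morph g ->
  f s = g s -> connected s t -> f t = g t.
Proof.
move=> fE gE fgs /(_ (fun x => f x = g x)); apply=> // x a y xy.
have [fxy gxy] := (fE _ _ _ xy, gE _ _ _ xy).
by split=> fg; [rewrite fg in fxy; exact: Edet fxy gxy|
                rewrite fg in fxy; exact: Ecodet fxy gxy].
Qed.

Hypothesis Ehom : forall s t, exists f g : T -> T,
  [/\ edge_morph f, edge_morph g, cancel f g, cancel g f & f s = t].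

Lemma homogeneous_group (x0 : T) : exists gT : Group T,
  let M := Group.Pack gT in
  forall (s t : M) a, E s a (s * t)%g <-> E (1%g : M) a t.
Proof.
have [rep [crep repE]] : exists rep : T -> T,
    (forall s, connected s (rep s)) /\
    forall s t, connected s t -> rep s = rep t.
  pose C : choiceType := HB.pack T (gen_eqMixin T) (gen_choiceMixin T).
  (* [xget] depends only on the set it is given, so all vertices of a component get the same
     representative. *)
  exists (fun s => @xget C x0 [set t : C | connected s t]); split=> [s|s t st].
    exact: (@xgetI C x0 [set t : C | connected s t] s (@connected_refl s)).
  congr (@xget C x0 _); apply/seteqP; split=> u; apply: connected_trans => //.
  exact: connected_sym.
have repK s : rep (rep s) = rep s by apply/esym/repE.
pose I := {s : T | rep s = s}.
have [gI] := @inhabited_group I (exist _ (rep x0) (repK x0)).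
pose gI' := Group.Pack gI.
pose comp (s : T) : gI' := exist _ (rep s) (repK s).
have comp_val (i : gI') : comp (sval i) = i.
  by case: i => i ri; exact: eq_exist.
have compE s t : connected s t -> comp s = comp t.
  by move=> /repE st; exact: eq_exist.
have ccomp s : connected s (sval (comp s)) by exact: crep.
pose r := sval (1%g : gI').
(* [au s] is an automorphism sending the base point [r] to [s], and [av s] is its inverse. *)
have /choice[au /choice[av auP]] s : exists f g : T -> T,
  [/\ edge_morph f, edge_morph g, cancel f g, cancel g f & f r = s] := Ehom r s.
have auE s : edge_morph (au s) by case: (auP s).
have avE s : edge_morph (av s) by case: (auP s).
have auK s : cancel (au s) (av s) by case: (auP s).
have avK s : cancel (av s) (au s) by case: (auP s).
have aur s : au s r = s by case: (auP s).
(* A vertex is encoded by its component [comp s] and by its position [c s], pulled back to the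
   component of [r]; [pt] is the decoding. *)
pose c (s : T) := av (sval (comp s)) s.
have cE s : s = au (sval (comp s)) (c s) by rewrite avK.
have cc s : connected r (c s).
  rewrite -[X in connected X _](auK (sval (comp s))) aur.
  by apply: edge_morph_connected => //; exact: connected_sym.
have coord_inj s t : comp s = comp t -> c s = c t -> s = t.
  by move=> st cst; rewrite (cE s) (cE t) st cst.
pose pt (i : gI') (x : T) := au (sval i) x.
have comp_pt i x : connected r x -> comp (pt i x) = i.
  move=> rx; rewrite -[RHS]comp_val; apply: compE; apply: connected_sym.
  by rewrite -[X in connected X _]aur; exact: (edge_morph_connected (auE _) rx).
have c_pt i x : connected r x -> c (pt i x) = x.
  by move=> rx; rewrite /c comp_pt// auK.
have cau x y : connected r x -> connected r y -> connected r (au x y).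
  move=> rx ry; apply: connected_trans rx _.
  by rewrite -[X in connected X _]aur; exact: edge_morph_connected.
have cav x : connected r x -> connected r (av x r).
  move=> rx; rewrite -[X in connected X _](auK x) aur.
  exact: (edge_morph_connected (avE _) (connected_sym rx)).
(* Direct product law: the group [gI'] acts on components, and in the component of [r] the product
   of [x] and [y] is [au x y], so that left translation by [x] is the automorphism [au x]. *)
pose mul s t := pt (comp s * comp t)%g (au (c s) (c t)).
pose inv s := pt (comp s)^-1%g (av (c s) r).
have compM s t : comp (mul s t) = (comp s * comp t)%g.
  by rewrite comp_pt//; exact: cau.
have cM s t : c (mul s t) = au (c s) (c t) by rewrite c_pt//; exact: cau.
have compV s : comp (inv s) = (comp s)^-1%g by rewrite comp_pt//; exact: cav.
have cV s : c (inv s) = av (c s) r by rewrite c_pt//; exact: cav.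
have comp1 : comp r = 1%g by exact: comp_val.
have c1 : c r = r by rewrite /c comp1 -/r -[X in av _ X](aur r) auK.
have au1 x : connected r x -> au r x = x.
  by apply: (@edge_morph_eq (au r) id) => //; rewrite aur.
have c_id x : connected r x -> c x = x.
  by move=> rx; rewrite /c -(compE _ _ rx) comp1 -/r -[X in av _ X]au1// auK.
have mulA : associative mul.
  move=> s t u; apply: coord_inj; first by rewrite !compM mulgA.
  rewrite !cM.
  (* Both sides are edge morphisms applied to [c u], and they agree at [r]. *)
  apply: (@edge_morph_eq (au (c s) \o au (c t)) _ r) => //=.
  - exact: edge_morph_comp.
  - by rewrite !aur.
have mul1 : left_id r mul.
  move=> s; apply: coord_inj; first by rewrite compM comp1 mul1g.
  by rewrite cM c1 au1.
have mulx1 : right_id r mul.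
  move=> s; apply: coord_inj; first by rewrite compM comp1 mulg1.
  by rewrite cM c1 aur.
have mulV : left_inverse r inv mul.
  move=> s; apply: coord_inj; first by rewrite compM compV comp1 mulVg.
  rewrite cM cV c1 -[RHS](auK (c s)) aur.
  by apply: (@edge_morph_eq _ _ r) => //; rewrite aur.
have mulxV : right_inverse r inv mul.
  move=> s; apply: coord_inj; first by rewrite compM compV comp1 mulgV.
  by rewrite cM cV c1 avK.
exists (group_of_axioms mulA mul1 mulx1 mulV mulxV) => M s t a.
change (E s a (mul s t) <-> E r a t).
(* For [t] in the component of [r], [mul s t] is the image of [t] under an automorphism [f] sending
   [r] to [s]. *)
have edge_mul : connected r t -> E s a (mul s t) <-> E r a t.
  move=> rt.
  have mulE : mul s t = au (sval (comp s)) (au (c s) t).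
    by rewrite /mul /pt -(compE _ _ rt) comp1 mulg1 (c_id t).
  pose f := au (sval (comp s)) \o au (c s).
  pose g := av (c s) \o av (sval (comp s)).
  have fE : edge_morph f by exact: edge_morph_comp.
  have gE : edge_morph g by exact: edge_morph_comp.
  have fK : cancel f g by exact: can_comp.
  have fr : f r = s by rewrite /f /= aur -cE.
  rewrite -[X in E X]fr mulE; split=> [/gE|/fE//].
  by rewrite fK; move: (fK t) => /= ->.
split=> [st|rt]; last by apply/edge_mul => //; exact: connected_edge rt.
(* An edge from [s] to [mul s t] stays in one component, which forces [comp t] to be 1. *)
apply/edge_mul => //.
have := compE _ _ (connected_edge st); rewrite compM => /esym compst.
have {}compst : comp t = 1%g by apply: (mulgI (comp s)); rewrite compst mulg1.
by apply: connected_sym; have := ccomp t; rewrite compst.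
Qed.

End Homogeneous.

(** * Generalized Cayley graphs of groups and their characterization *)

Lemma vertices_gcayley (V A : Type) (M : set V) (gM : Group M)
    (Q : set (Group.Pack gM)) (lab : Q -> A) :
  let G := edge_incl (@gcayley (Group.Pack gM) Q A lab) in
  G !=set0 -> vertices G = M.
Proof.
move=> G [_ [_ [_ [q _]] _]]; apply/seteqP; split=> [s [a [t []]]|s Ms].
- by move=> [_ [p [q' ->]] [<- _ _]]; exact/set_mem/valP.
- by move=> [_ [p [q' ->]] [_ _ <-]]; exact/set_mem/valP.
(* Nonemptiness of [G] supplied some [q] in [Q], hence an edge leaving every element of [M]. *)
- pose p : Group.Pack gM := exist _ s (mem_set Ms).
  exists (lab q), (val (p * val q)%g); left.
  by exists (p, lab q, (p * val q)%g) => //; exists p, q.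
Qed.

Lemma gcayley_of_group_properties (V A : Type) (G : edge_set V A) :
  G !=set0 -> gcayley_of_group G ->
  [/\ simple G, deterministic G, co_deterministic G & symmetric_graph G].
Proof.
move=> G0 [M [gM [Q [lab [lab_inj GE]]]]].
pose gT := Group.Pack gM.
have edgeE s a t : G (s, a, t) <->
    exists (p : gT) (q : Q), [/\ s = val p, a = lab q & t = val (p * val q)%g].
  rewrite GE; split=> [[_ [p [q ->]] [<- <- <-]]|[p [q [-> -> ->]]]].
    by exists p, q.
  by exists (p, lab q, (p * val q)%g) => //; exists p, q.
have VM : vertices G = M by rewrite GE in G0 *; exact: vertices_gcayley.
have vinj (x y : gT) : val x = val y -> x = y by exact: val_inj.
split.
- move=> s a b t /edgeE[p [q [-> -> ->]]] /edgeE[p' [q' [/vinj <- ->]]].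
  by move=> /vinj /mulgI /val_inj ->.
- move=> s a t u /edgeE[p [q [-> -> ->]]] /edgeE[p' [q' [/vinj <-]]].
  by move=> /lab_inj <- ->.
- move=> r a s t /edgeE[p [q [-> -> ->]]] /edgeE[p' [q' [->]]].
  by move=> /lab_inj <- /vinj /mulIg ->.
- rewrite /symmetric_graph /automorphism VM => s t Ms Mt.
  pose el x (Mx : M x) : gT := exist _ x (mem_set Mx).
  (* Left translation by [h] takes [s] to [t]; [f] extends it by the identity outside [M]. *)
  pose h : gT := (el t Mt * (el s Ms)^-1)%g.
  pose f x := if pselect (M x) is left Mx then val (h * el x Mx)%g else x.
  have fE (x : gT) : f (val x) = val (h * x)%g.
    rewrite /f; case: pselect => [Mx|[]]; last exact/set_mem/valP.
    by congr (val (h * _)%g); exact: vinj.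
  have elP x : M x -> exists y : gT, x = val y by move=> Mx; exists (el x Mx).
  exists f; last by rewrite (fE (el s Ms)) /h mulgVK.
  split; first split.
  + by move=> _ /elP[x ->]; rewrite /= fE; exact/set_mem/valP.
  + move=> _ _ /set_mem/elP[x ->] /set_mem/elP[y ->].
    by rewrite !fE => /vinj /mulgI ->.
  + move=> _ /elP[x ->]; exists (val (h^-1 * x)%g); last by rewrite fE mulVKg.
    exact/set_mem/valP.
  + move=> _ a _ /elP[x ->] /elP[y ->]; rewrite !fE; split.
      move=> /edgeE[p [q [/vinj -> -> /vinj ->]]]; apply/edgeE.
      by exists (h * p)%g, q; split=> //; rewrite mulgA.
    move=> /edgeE[p [q [/vinj xp -> /vinj yp]]]; apply/edgeE; exists x, q.
    by split=> //; congr val; apply: (mulgI h); rewrite yp mulgA xp.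
Qed.

Theorem theorem4p10 (V A : Type) (G : edge_set V A) (G_neq0 : G !=set0) :
  gcayley_of_group G <->
  [/\ simple G, deterministic G, co_deterministic G & symmetric_graph G].
Proof.
split; first exact: gcayley_of_group_properties.
move=> [Gsimple Gdet Gcodet Gsym].
pose M := vertices G.
pose E (s : M) a (t : M) := G (val s, a, val t).
have valM (x : M) : vertices G (val x) by exact/set_mem/valP.
have Edet r a s t : E r a s -> E r a t -> s = t.
  by move=> rs rt; apply/val_inj/(Gdet _ _ _ _ rs rt).
have Ecodet r a s t : E s a r -> E t a r -> s = t.
  by move=> sr tr; apply/val_inj/(Gcodet _ _ _ _ sr tr).
(* Automorphisms of [G] are restricted to the type of its vertices, where they have two-sided
   inverses. *)
have Ehom s t : exists f g : M -> M,
    [/\ edge_morph E f, edge_morph E g, cancel f g, cancel g f & f s = t].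
  have [f [[fM /in_set2P finj fsurj] fE] fst] := Gsym _ _ (valM s) (valM t).
  have fP (x : M) : f (val x) \in M by apply/mem_set/fM.
  pose F (x : M) : M := SigSub (fP x).
  have /choice[F' FK] (y : M) : exists x, F x = y.
    have [x Mx xy] := fsurj _ (valM y).
    by exists (exist _ x (mem_set Mx)); exact: val_inj.
  have Finj : injective F.
    by move=> x y /(congr1 val) /finj xy; apply/val_inj/xy.
  have FE x a y : E x a y <-> E (F x) a (F y) by exact: fE.
  exists F, F'; split=> //.
  - by move=> x a y /FE.
  - by move=> x a y xy; apply/FE; rewrite !FK.
  - by move=> x; apply: Finj; rewrite FK.
  - exact: val_inj.
have [[[s0 a0] t0] G0] := G_neq0.
have Ms0 : s0 \in M by apply/mem_set; exists a0, t0; left.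
have [gM GM] := homogeneous_group Edet Ecodet Ehom (exist _ s0 Ms0).
pose gT := Group.Pack gM; rewrite -/gT in GM.
(* [Q] consists of the out-neighbours of 1, each labeled by an edge from 1 to it. Determinism makes
   this labeling injective. *)
pose Q : set gT := [set q | exists a, E (1%g : gT) a q].
have labP (q : Q) : exists a, E (1%g : gT) a (val q) := set_mem (valP q).
have /choice[lab labE] := labP.
exists M, gM, Q, lab; split.
  move=> q q' qq'; apply/val_inj/(Edet (1%g : gT) (lab q)) => //.
  by rewrite qq'.
apply/seteqP; split=> [[[s a] t] Gst|_ [_ [p [q ->]] <-] /=]; last first.
  by apply/(GM p); exact: labE.
have Ms : s \in M by apply/mem_set; exists a, t; left.
have Mt : t \in M by apply/mem_set; exists a, s; right.
pose p : gT := exist _ s Ms; pose u : gT := exist _ t Mt.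
(* The edge from [p] to [u] is translated back to 1; simplicity then identifies its label with the
   one chosen by [lab]. *)
have Eq : E (1%g : gT) a (p^-1 * u)%g by apply/(GM p); rewrite mulVKg.
have Qq : (p^-1 * u)%g \in Q by apply/mem_set; exists a.
pose q : Q := SigSub Qq.
exists (p, lab q, (p * val q)%g); first by exists p, q.
have -> : lab q = a by apply: Gsimple (labE q) Eq.
by rewrite /= mulVKg.
Qed.
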